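(* Let $P$ be an ideal projector on $\mathbb{F}[\bm{x}]=\mathbb{F}[x_1,\ldots,x_d]$. Suppose that the ideal $\ker P$ has a universal reduced Gröbner basis $G=\{g_1,\ldots,g_m\}$ (that is, $G$ is the reduced Gröbner basis of $\ker P$ with respect to every monomial order) whose elements have the form $$g_j=\bm{x}^{\bm{\alpha}^{(j)}}-\sum_{\bm{0}\le\bm{\beta}<\bm{\alpha}^{(j)}}c_{j,\bm{\beta}}\,\bm{x}^{\bm{\beta}},\qquad 1\le j\le m,\quad c_{j,\bm{\beta}}\in\mathbb{F},$$ and suppose that the range of $P$ is $$\operatorname{ran}P=\mathrm{span}_{\mathbb{F}}\{\bm{x}^{\bm{\beta}}:\ \bm{\beta}\in\mathbb{N}^d,\ \bm{x}^{\bm{\alpha}^{(j)}}\nmid\bm{x}^{\bm{\beta}}\text{ for all }1\le j\le m\}.$$ Then $G$ is an ideal basis for $\ker P$ that admits a ''good'' error formula.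
   Context: $\mathbb{F}$ is a field of characteristic zero and $\mathbb{F}[\bm{x}]=\mathbb{F}[x_1,\ldots,x_d]$. $\mathbb{N}$ denotes the nonnegative integers. For $\bm{\alpha},\bm{\beta}\in\mathbb{N}^d$, $\bm{\alpha}\le\bm{\beta}$ means $\alpha_i\le\beta_i$ for all $i$, and $\bm{\alpha}<\bm{\beta}$ means $\bm{\alpha}\le\bm{\beta}$ and $\bm{\alpha}\ne\bm{\beta}$. A linear operator $P:\mathbb{F}[\bm{x}]\to\mathbb{F}[\bm{x}]$ is an ideal projector if $P^2=P$ and $\ker P$ is an ideal. For a polynomial $f=\sum c_{\bm{\alpha}}\bm{x}^{\bm{\alpha}}$, write $f(D)=\sum c_{\bm{\alpha}}D^{\bm{\alpha}}$ with $D^{\bm{\alpha}}=\partial^{\alpha_1+\cdots+\alpha_d}/\partial x_1^{\alpha_1}\cdots\partial x_d^{\alpha_d}$. ''Good'' error formula: let $P$ be an ideal projector and let $\{h_1,\ldots,h_m\}$ be an ideal basis for $\ker P$ (a finite set generating the ideal $\ker P$). The basis $\{h_1,\ldots,h_m\}$ admits a ''good'' error formula if there exist homogeneous polynomials $H_j$ and linear operators $C_j:\mathbb{F}[\bm{x}]\to\mathbb{F}[\bm{x}]$, $j=1,\ldots,m$, such that $H_j(D)h_k=\delta_{j,k}$ for all $j,k=1,\ldots,m$, and for all $f\in\mathbb{F}[\bm{x}]$, $f-Pf=\sum_{j=1}^m C_j(H_j(D)f)\,h_j$. *)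

(* Defs.v *)
From mathcomp Require Import all_boot all_order all_algebra.
From mathcomp Require Export mpoly.

Set Implicit Arguments.
Unset Strict Implicit.
Unset Printing Implicit Defensive.

Import GRing.Theory.
Local Open Scope ring_scope.

Definition lin_span (K : fieldType) (V : lmodType K) (S : V -> Prop) (v : V) :
    Prop :=
  exists (n : nat) (a : 'I_n -> K) (s : 'I_n -> V),
    (forall i, S (s i)) /\ v = \sum_(i < n) a i *: s i.

Section Ideals.
Context {A : comNzRingType}.
Implicit Types (I S : A -> Prop) (f p q : A).

(* The improper ideal is allowed, unlike in [idealr_closed]: it is the kernel
   of the zero projector. *)
Definition is_ideal I : Prop :=
  [/\ I 0, (forall p q, I p -> I q -> I (p + q))
    & forall p q, I q -> I (p * q)].

Definition ideal_gen S f : Prop :=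
  exists (n : nat) (q s : 'I_n -> A),
    (forall i, S (s i)) /\ f = \sum_(i < n) q i * s i.

Definition in_family (m : nat) (h : 'I_m -> A) f : Prop := exists j, f = h j.

Definition ideal_basis (m : nat) I (h : 'I_m -> A) : Prop :=
  forall f, I f <-> ideal_gen (in_family h) f.
End Ideals.

Section Operators.
Context {F : fieldType} {d : nat}.
Implicit Types (P : {linear {mpoly F[d]} -> {mpoly F[d]}}) (f h : {mpoly F[d]}).

Definition in_ker P f : Prop := P f = 0.
Definition in_ran P f : Prop := exists h, f = P h.

Definition ideal_projector P : Prop :=
  (forall f, P (P f) = P f) /\ is_ideal (in_ker P).

(* f(D) h *)
Definition diffop f h : {mpoly F[d]} :=
  \sum_(a <- msupp f) f@_a *: h^`M[a].

Definition good_error_formula P (m : nat) (h : 'I_m -> {mpoly F[d]}) : Prop :=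
  exists (H : 'I_m -> {mpoly F[d]})
         (C : 'I_m -> {linear {mpoly F[d]} -> {mpoly F[d]}}),
    [/\ forall j, H j \is homog mdeg,
        forall j k, diffop (H j) (h k) = (j == k)%:R
      & forall f, f - P f = \sum_(j < m) C j (diffop (H j) f) * h j].
End Operators.

(* Total order on exponents with least element 0 and compatible with addition;
   by Dickson's lemma such an order is a well-order. *)
Definition monomial_order (d : nat) (le : rel 'X_{1..d}) : Prop :=
  [/\ [/\ reflexive le, antisymmetric le, transitive le & total le],
      (forall a, le 0%MM a)
    & forall a b c, le a b -> le (a + c)%MM (b + c)%MM].

Section Groebner.
Context {F : fieldType} {d : nat}.
Implicit Types (le : rel 'X_{1..d}) (f : {mpoly F[d]}) (a b : 'X_{1..d}).
Implicit Types (I S : {mpoly F[d]} -> Prop).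

Definition is_lead le f a : Prop :=
  a \in msupp f /\ {in msupp f, forall b, le b a}.

Definition lead_monomials le S : {mpoly F[d]} -> Prop :=
  fun t => exists f a, [/\ S f, is_lead le f a & t = 'X_[a]].

Definition groebner_basis le I (m : nat) (g : 'I_m -> {mpoly F[d]}) : Prop :=
  (forall j, I (g j)) /\
  (forall t, ideal_gen (lead_monomials le I) t <->
             ideal_gen (lead_monomials le (in_family g)) t).

(* The last clause compares different indices, so it also makes g injective:
   g enumerates a set of exactly m polynomials. *)
Definition reduced_groebner_basis le I (m : nat) (g : 'I_m -> {mpoly F[d]}) :
    Prop :=
  [/\ groebner_basis le I g,
      (forall j, g j != 0),
      (forall j a, is_lead le (g j) a -> (g j)@_a = 1)
    & forall j k a b, j != k -> is_lead le (g k) a -> b \in msupp (g j) ->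
        ~~ (a <= b)%MM].

Definition universal_reduced_groebner_basis I (m : nat)
    (g : 'I_m -> {mpoly F[d]}) : Prop :=
  forall le, monomial_order le -> reduced_groebner_basis le I g.
End Groebner.

(* Main.v *)
Require Import Defs.
From HB Require Import structures.
From mathcomp Require Import all_boot all_order all_algebra.
From mathcomp Require Import ssrcomplements mpoly.

(** The operators are H_j = x^(alpha_j) / alpha_j!.  Every term of g_j divides
    its leading monomial x^(alpha_j), and by reducedness no term of g_k with
    k != j is divisible by x^(alpha_j); so D^(alpha_j) kills every term of the
    family except the leading term of g_j, which gives H_j(D) g_k = delta_jk.

    For the error formula, divide a monomial x^b by G.  A step replaces a
    multiple x^(t + alpha_k) by the monomials x^(t + a), where x^a runs over
    the lower terms of g_k; all of them divide x^(t + alpha_k).  So only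
    divisors of x^b ever occur, and a generator g_j is used only if alpha_j <= b
    ([division_by_divisors]).  The irreducible monomials are fixed by P, hence
      x^b - P x^b = sum_j q_(b,j) g_j   with q_(b,j) = 0 unless alpha_j <= b.
    For each j, the linear map x^b |-> q_(b,j) thus vanishes on the kernel of
    D^(alpha_j), which in characteristic zero is spanned by the monomials that
    are not multiples of x^(alpha_j); so it factors through D^(alpha_j)
    ([factor_through_mderivm]), and the other factor is, up to the scalar
    alpha_j!, the operator C_j.  The error formula in turn shows that G
    generates ker P. *)

Set Implicit Arguments.
Unset Strict Implicit.
Unset Printing Implicit Defensive.

Import GRing.Theory.
Local Open Scope ring_scope.

(** * Linear maps given by their values on monomials *)

Section LinearExtension.
Context {F : fieldType} {d : nat} {V : lmodType F}.
Implicit Types (phi : 'X_{1..d} -> V) (p : {mpoly F[d]}).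

Definition mpoly_ext phi p : V := \sum_(a <- msupp p) p@_a *: phi a.

(** Linearity needs one index set that serves several polynomials at once. *)
Lemma mpoly_extwE phi p k : (msize p <= k)%N ->
  mpoly_ext phi p = \sum_(a : 'X_{1..d < k}) p@_a *: phi a.
Proof.
move=> le_pk; set I : subFinType _ := 'X_{1..d < k}.
rewrite /mpoly_ext (big_mksub I) ?msupp_uniq //=; first last.
  by move=> a /msize_mdeg_lt /leq_trans; apply.
rewrite big_rmcond //= => a /memN_msupp_eq0 ->.
by rewrite scale0r.
Qed.

Lemma mpoly_ext_is_linear phi : linear (mpoly_ext phi).
Proof.
move=> u p q.
pose k := maxn (msize (u *: p + q)) (maxn (msize p) (msize q)).
rewrite !(mpoly_extwE phi (k := k)) ?leq_max ?leqnn ?orbT //.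
rewrite scaler_sumr -big_split /=; apply: eq_bigr => a _.
by rewrite mcoeffD mcoeffZ scalerDl scalerA.
Qed.

HB.instance Definition _ phi :=
  GRing.isLinear.Build F {mpoly F[d]} V _ (mpoly_ext phi)
    (mpoly_ext_is_linear phi).

Lemma mpoly_extX phi a : mpoly_ext phi 'X_[a] = phi a.
Proof. by rewrite /mpoly_ext msuppX big_seq1 mcoeffX eqxx scale1r. Qed.

End LinearExtension.

(** * Derivatives of monomials in characteristic zero *)

Section Derivatives.
Context {F : fieldType} {d : nat}.
Implicit Types (a b : 'X_{1..d}) (p : {mpoly F[d]}).

Definition mnm_ffact b a : F := (\prod_(i < d) (b i) ^_ (a i))%:R.

Lemma mderivmXE b a :
  ('X_[b] : {mpoly F[d]})^`M[a] = mnm_ffact b a *: 'X_[b - a].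
Proof. exact: mderivmX. Qed.

Lemma mnm_ffact_eq0 b a : ~~ (a <= b)%MM -> mnm_ffact b a = 0.
Proof.
rewrite negb_forall => /existsP[i]; rewrite -ltnNge => lt_ba.
by rewrite /mnm_ffact (bigD1 i) //= ffact_small.
Qed.

Lemma mnm_ffact_neq0 b a :
  [pchar F] =i pred0 -> (a <= b)%MM -> mnm_ffact b a != 0.
Proof.
move=> /pcharf0P charF0 /mnm_lepP le_ab; rewrite charF0 -lt0n.
by apply: prodn_gt0 => i; rewrite ffact_gt0.
Qed.

(** D^a kills the monomials that x^a does not divide, and D^a x^a = a!.  Covers
    both H_j(D) g_j = 1 and H_j(D) g_k = 0: in the latter case x^a does not
    occur in p at all. *)
Lemma mderivm_isolated a p :
  (forall b, b \in msupp p -> (a <= b)%MM -> b = a) ->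
  p^`M[a] = p@_a *: (mnm_ffact a a)%:MP.
Proof.
move=> isol; rewrite {1}[p]mpolyE linear_sum /=.
have term b : b \in msupp p -> b != a -> (p@_b *: 'X_[b])^`M[a] = 0.
  move=> b_p ne_ba; rewrite linearZ /= mderivmXE mnm_ffact_eq0 ?scale0r ?scaler0 //.
  by apply: contra ne_ba => /(isol _ b_p) ->.
have [a_p | a_p] := boolP (a \in msupp p).
  rewrite (bigD1_seq a) ?msupp_uniq //= big_seq_cond big1 => [|b /andP[]]; last exact: term.
  rewrite addr0 linearZ /= mderivmXE.
  suff -> : (a - a)%MM = 0%MM by rewrite mpolyX0 alg_mpolyC.
  by apply/mnmP => i; rewrite mnmBE mnm0E subnn.
rewrite (memN_msupp_eq0 a_p) scale0r big_seq big1 // => b b_p.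
by apply: term => //; apply: contraNneq a_p => <-.
Qed.

(** D^a maps the multiples of x^a to nonzero multiples of the distinct monomials
    x^(b - a), so a linear map vanishing on all other monomials, which span the
    kernel of D^a, factors through D^a. *)
Lemma factor_through_mderivm (V : lmodType F) a
    (L : {linear {mpoly F[d]} -> V}) :
  [pchar F] =i pred0 -> (forall b, ~~ (a <= b)%MM -> L 'X_[b] = 0) ->
  exists C : {linear {mpoly F[d]} -> V}, forall p, C p^`M[a] = L p.
Proof.
move=> charF0 L0.
pose phi e := (mnm_ffact (e + a) a)^-1 *: L 'X_[e + a].
exists (mpoly_ext phi) => p; rewrite [p]mpolyE !linear_sum /=.
apply: eq_bigr => b _; rewrite !linearZ /= mderivmXE linearZ /= mpoly_extX.
congr (_ *: _).
have [le_ab | nle_ab] := boolP (a <= b)%MM.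
  by rewrite /phi submK // scalerA divff ?mnm_ffact_neq0 // scale1r.
by rewrite mnm_ffact_eq0 // scale0r L0.
Qed.

Lemma diffopZX (u : F) a p : diffop (u *: 'X_[a]) p = u *: p^`M[a].
Proof.
have [-> | u_neq0] := eqVneq u 0; first by rewrite /diffop !scale0r msupp0 big_nil.
by rewrite /diffop msuppMCX // big_seq1 mcoeffZ mcoeffX eqxx mulr1.
Qed.

End Derivatives.

(** * Ideals generated by part of a family *)

Section PartialIdeal.
Context {A : comNzRingType} {m : nat}.
Implicit Types (s : pred 'I_m) (g : 'I_m -> A) (f : A) (q : {ffun 'I_m -> A}).

(** Boolean, and on a finite function, so that the cofactors form a decidable
    subset of a choice type and [xchoose] can select them. *)
Definition cofactors_on s g f q : bool :=
  [forall j, s j || (q j == 0)] && (f == \sum_(j < m) q j * g j).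

Definition ideal_on s g f : Prop := exists q, cofactors_on s g f q.

Lemma cofactors_onP s g f q :
  reflect ((forall j, ~~ s j -> q j = 0) /\ f = \sum_(j < m) q j * g j)
          (cofactors_on s g f q).
Proof.
apply: (iffP andP) => -[q0 /eqP->]; split=> //.
  by move=> j; have /orP[-> | /eqP] := forallP q0 j.
by apply/forallP => j; case: (boolP (s j)) => //= /q0->.
Qed.

Lemma ideal_on0 s g : ideal_on s g 0.
Proof.
exists [ffun=> 0]; apply/cofactors_onP; split=> [j _|]; first by rewrite ffunE.
by rewrite big1 // => j _; rewrite ffunE mul0r.
Qed.

Lemma ideal_onD s g f1 f2 :
  ideal_on s g f1 -> ideal_on s g f2 -> ideal_on s g (f1 + f2).
Proof.
move=> [q1 /cofactors_onP[q10 ->]] [q2 /cofactors_onP[q20 ->]].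
exists [ffun j => q1 j + q2 j]; apply/cofactors_onP; split=> [j sj|].
  by rewrite ffunE q10 // q20 // addr0.
by rewrite -big_split; apply: eq_bigr => j _; rewrite ffunE mulrDl.
Qed.

Lemma ideal_onM s g p f : ideal_on s g f -> ideal_on s g (p * f).
Proof.
move=> [q /cofactors_onP[q0 ->]].
exists [ffun j => p * q j]; apply/cofactors_onP; split=> [j sj|].
  by rewrite ffunE q0 // mulr0.
by rewrite mulr_sumr; apply: eq_bigr => j _; rewrite ffunE mulrA.
Qed.

Lemma ideal_on_gen s g k : s k -> ideal_on s g (g k).
Proof.
move=> sk; exists [ffun j => (j == k)%:R]; apply/cofactors_onP; split=> [j|].
  by rewrite ffunE; case: eqP => // ->; rewrite sk.
rewrite (bigD1 k) //= big1 => [|j /negPf ne_jk]; rewrite ffunE ?eqxx ?ne_jk.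
  by rewrite mul1r addr0.
exact: mul0r.
Qed.

Lemma ideal_onS s1 s2 g f :
  (forall j, s1 j -> s2 j) -> ideal_on s1 g f -> ideal_on s2 g f.
Proof.
move=> s12 [q /cofactors_onP[q0 ->]]; exists q; apply/cofactors_onP.
by split=> // j ns2; apply: q0; apply: contra ns2 => /s12.
Qed.

End PartialIdeal.

(** * Division of monomials *)

Section Division.
Context {F : fieldType} {d m : nat}.
Variables (P : {linear {mpoly F[d]} -> {mpoly F[d]}}).
Variables (g : 'I_m -> {mpoly F[d]}) (alpha : 'I_m -> 'X_{1..d}).

(** The monomials produced by dividing x^b all divide x^b, so a generator whose
    leading monomial does not divide x^b is never used. *)
Lemma division_by_divisors :
  (forall j p, P (p * g j) = 0) ->
  (forall j, (g j)@_(alpha j) = 1) ->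
  (forall j a, a \in msupp (g j) -> (a <= alpha j)%MM) ->
  (forall b, (forall j, ~~ (alpha j <= b)%MM) -> P 'X_[b] = 'X_[b]) ->
  forall b, ideal_on (fun j => (alpha j <= b)%MM) g ('X_[b] - P 'X_[b]).
Proof.
move=> Pg lead1 supp_le Pnormal; apply: ltmwf => b IHb.
have [/existsP[k le_kb] | no_lead] := boolP [exists j, (alpha j <= b)%MM];
  last first.
  rewrite Pnormal ?subrr => [|j]; first exact: ideal_on0.
  by apply: contra no_lead => le_jb; apply/existsP; exists j.
set t := (b - alpha k)%MM.
have bE : (alpha k + t)%MM = b by rewrite addmC submK.
have lead_k : alpha k \in msupp (g k).
  by rewrite mcoeff_msupp lead1 oner_neq0.
(* One division step: the residual monomials x^(a + t) properly divide x^b. *)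
have stepE : 'X_[b] = 'X_[t] * g k
    - \sum_(a <- msupp (g k) | a != alpha k) (g k)@_a *: 'X_[a + t].
  rewrite {1}[g k]mpolyE (bigD1_seq (alpha k)) ?msupp_uniq //= lead1 scale1r.
  rewrite mulrDr -mpolyXD addmC bE mulr_sumr.
  under [X in _ - X]eq_bigr => a _ do rewrite mpolyXD mulrC scalerAr.
  by rewrite addrK.
have -> : 'X_[b] - P 'X_[b] = 'X_[t] * g k
    + \sum_(a <- msupp (g k) | a != alpha k)
        (- (g k)@_a)%:MP * ('X_[a + t] - P 'X_[a + t]).
  rewrite stepE linearB /= Pg linear_sum /= sub0r opprK -addrA; congr (_ + _).
  rewrite linear_sum -big_split; apply: eq_bigr => a _ /=.
  by rewrite mul_mpolyC scaleNr scalerBr opprB addrC [P (_ *: _)]linearZ.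
apply: ideal_onD; first exact/ideal_onM/ideal_on_gen.
rewrite big_seq_cond; apply: big_ind => [||a /andP[a_gk ne_a]].
- exact: ideal_on0.
- by move=> ? ?; apply: ideal_onD.
have le_a := supp_le _ _ a_gk.
apply: ideal_onM; apply: ideal_onS (IHb _ _) => [j /lepm_trans|].
  by apply; rewrite -bE; apply/mnm_lepP => i; rewrite !mnmDE leq_add2r (mnm_lepP le_a).
by rewrite -bE ltmc_add2l Order.POrderTheory.lt_neqAle ne_a lem_leo.
Qed.

End Division.

(** * Leading monomials *)

(** Gives access to reducedness: x^(alpha_j) is the leading monomial of g_j for
    any monomial order, because all the terms of g_j divide it. *)
Lemma deglex_monomial_order d :
  monomial_order (fun a b : 'X_{1..d} => (a <= b)%O).
Proof.
split=> [||a b c]; last by rewrite lemc_add2l.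
  split; [exact: Order.POrderTheory.lexx | exact: Order.POrderTheory.le_anti
         | exact: Order.POrderTheory.le_trans | exact: Order.TotalTheory.le_total].
exact: le0m.
Qed.

Lemma msupp_below_lead (F : fieldType) d (p : {mpoly F[d]}) a
    (u : 'X_{1..d} -> F) :
  p = 'X_[a] - \sum_(b : 'X_{1..d < (mdeg a).+1} | (b < a)%MM) u b *: 'X_[b] ->
  p@_a = 1 /\ forall b, b \in msupp p -> (b <= a)%MM.
Proof.
move=> ->; split=> [|b].
  rewrite mcoeffB mcoeffX eqxx raddf_sum big1 ?subr0 // => b /andP[/negPf ne_ba _].
  by rewrite /= mcoeffZ mcoeffX ne_ba mulr0.
apply: contraLR => nle_ba; rewrite mcoeff_msupp negbK mcoeffB mcoeffX raddf_sum.
rewrite big1 => [|e /andP[_ le_ea]] /=.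
  by case: (eqVneq a b) nle_ba => [-> | _]; rewrite ?lepm_refl ?subrr.
by rewrite mcoeffZ mcoeffX; case: (eqVneq (val e) b) nle_ba => [<- | _]; rewrite ?le_ea ?mulr0.
Qed.

Theorem theorem6 (F : fieldType) (charF0 : [pchar F] =i pred0) (d : nat)
    (P : {linear {mpoly F[d]} -> {mpoly F[d]}}) (P_proj : ideal_projector P)
    (m : nat) (g : 'I_m -> {mpoly F[d]})
    (g_univ : universal_reduced_groebner_basis (in_ker P) g)
    (alpha : 'I_m -> 'X_{1..d}) (c : 'I_m -> 'X_{1..d} -> F)
    (g_form : forall j : 'I_m,
       g j = 'X_[alpha j]
             - \sum_(b : 'X_{1..d < (mdeg (alpha j)).+1} | (b < alpha j)%MM)
                 c j b *: 'X_[b])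
    (ranP : forall f : {mpoly F[d]},
       in_ran P f <->
       lin_span (fun t : {mpoly F[d]} =>
         exists2 b : 'X_{1..d},
           (forall j : 'I_m, ~~ (alpha j <= b)%MM) & t = 'X_[b]) f) :
  ideal_basis (in_ker P) g /\ good_error_formula P g.
Proof.
have lead1 j : (g j)@_(alpha j) = 1 by case: (msupp_below_lead (g_form j)).
have supp_le j b : b \in msupp (g j) -> (b <= alpha j)%MM.
  by case: (msupp_below_lead (g_form j)) => _; apply.
have [PP [ker0 kerD kerM]] := P_proj.
have [[ker_g _] _ _ reduced] := g_univ _ (deglex_monomial_order d).
have g_isolated j k b : b \in msupp (g k) -> (alpha j <= b)%MM ->
    j = k /\ b = alpha j.
  move=> b_gk le_jb; have [eq_jk | ne_jk] := eqVneq j k.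
    split=> //; apply/mnmP => i; apply/eqP; rewrite eqn_leq (mnm_lepP le_jb) andbT.
    by move: (supp_le _ _ b_gk); rewrite eq_jk => /mnm_lepP.
  have lead_j : is_lead (fun a e : 'X_{1..d} => (a <= e)%O) (g j) (alpha j).
    split; first by rewrite mcoeff_msupp lead1 oner_neq0.
    by move=> e /supp_le/lem_leo.
  rewrite eq_sym in ne_jk.
  by move: (reduced _ _ _ _ ne_jk lead_j b_gk); rewrite le_jb.
have Pnormal b : (forall j, ~~ (alpha j <= b)%MM) -> P 'X_[b] = 'X_[b].
  move=> normal_b; have [] : in_ran P 'X_[b]; last by move=> f ->; rewrite PP.
  apply/ranP; exists 1%N, (fun=> 1), (fun=> 'X_[b]).
  by rewrite big_ord1 scale1r; split=> // _; exists b.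
have division := division_by_divisors (fun j p => kerM p _ (ker_g j)) lead1
  supp_le Pnormal.
pose q b := xchoose (division b).
have q_off j b : ~~ (alpha j <= b)%MM -> q b j = 0.
  by move: j; case: (cofactors_onP _ _ _ _ (xchooseP (division b))).
have qE b : 'X_[b] - P 'X_[b] = \sum_j q b j * g j.
  by case: (cofactors_onP _ _ _ _ (xchooseP (division b))).
pose fct j : F := mnm_ffact (alpha j) (alpha j).
have fct_neq0 j : fct j != 0 by rewrite mnm_ffact_neq0 ?lepm_refl.
(* The scalar alpha_j! compensates the denominator of H_j. *)
have /fin_all_exists[C CE] : forall j,
    exists C : {linear {mpoly F[d]} -> {mpoly F[d]}},
      forall p, C p^`M[alpha j] = mpoly_ext (fun b => fct j *: q b j) p.
  move=> j; apply: factor_through_mderivm => // b nle_jb.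
  by rewrite /= mpoly_extX q_off ?scaler0.
pose H j : {mpoly F[d]} := (fct j)^-1 *: 'X_[alpha j].
have error f : f - P f = \sum_(j < m) C j (diffop (H j) f) * g j.
  under eq_bigr => j _ do rewrite diffopZX linearZ /= CE.
  rewrite {1 2}[f]mpolyE linear_sum -sumrB /=.
  under eq_bigr => b _ do rewrite linearZ /= -scalerBr qE scaler_sumr.
  rewrite exchange_big /=; apply: eq_bigr => j _.
  rewrite /mpoly_ext scaler_sumr mulr_suml; apply: eq_bigr => b _.
  rewrite scalerAl; congr (_ * _).
  by rewrite !scalerA mulrAC mulVf // mul1r.
split; last first.
  exists H, C; split=> // [j | j k].
    by apply/homogP; exists (mdeg (alpha j)); rewrite dhomogZ // dhomogX.
  rewrite diffopZX mderivm_isolated => [|b b_gk /(g_isolated _ _ _ b_gk)[]//].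
  have [<- | ne_jk] := eqVneq j k.
    by rewrite lead1 scale1r -mul_mpolyC -mpolyCM mulVf.
  rewrite memN_msupp_eq0 ?scale0r ?scaler0 //; apply: contra ne_jk.
  by move=> /(g_isolated j)/(_ (lepm_refl _))[->].
move=> f; split=> [Pf0 | [n [p [s [s_g ->]]]]].
  exists m, (fun j => C j (diffop (H j) f)), g.
  by split=> [j|]; [exists j | rewrite -error Pf0 subr0].
apply: big_ind => // i _; apply: kerM.
by case: (s_g i) => j ->; apply: ker_g.
Qed.
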